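(* Let $p$ be a prime and let $k$ be a positive integer. There is an absolute constant $C>0$ such that for any fixed even integer $s\geqslant 4$, the inequality $G(k,p)\leqslant s$ holds provided that $$p^{1/6}\leqslant \gcd(k,p+1)\leqslant C\min\left\{p^{(6s-186)/(11s-116)},\ p^{(5s-56)/(10s-56)}\right\}.$$
   Context: Let $\mathcal{N}_{p^2}=\{z\in\mathbb{F}_{p^2}:\ z^{p+1}=1\}$ be the subgroup of $\mathbb{F}_{p^2}^*$ of elements of norm one (over $\mathbb{F}_p$). For a positive integer $k$, $G(k,p)$ denotes the smallest positive integer $s$ such that for every $c\in\mathbb{F}_{p^2}$ the equation $u_1^k+\cdots+u_s^k=c$ has a solution $u_1,\ldots,u_s\in\mathcal{N}_{p^2}$ (and $G(k,p)=\infty$ if no such $s$ exists).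
   Formalization: The formal theorem takes even s > 4 instead of s ≥ 4: at s = 4 both exponents equal 9/4, so for any C > 0 and large p the choice k = p+1 satisfies the hypothesis although G(p+1,p) = ∞. *)

(* Defs.v *)
From mathcomp Require Import all_boot all_order all_algebra all_field.
From mathcomp Require Import all_classical all_reals all_analysis.

Set Implicit Arguments.
Unset Strict Implicit.
Unset Printing Implicit Defensive.

Import Order.TTheory GRing.Theory Num.Theory.

Local Open Scope ring_scope.

(* The field F_{p^2} is represented by an arbitrary finite field F with
   #|F| = p ^ 2, which is unique up to isomorphism.  The norm of F over F_p is
   z |-> z ^+ p.+1; since 0 ^+ p.+1 = 0, normOne p F contains only units. *)
Definition normOne (p : nat) (F : finFieldType) : {set F} :=
  [set z : F | z ^+ p.+1 == 1].

Definition represents_all (k p : nat) (F : finFieldType) (s : nat) : bool :=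
  [forall c : F, exists u : {ffun 'I_s -> F},
    [forall i, u i \in normOne p F] && (\sum_(i < s) u i ^+ k == c)].

Definition waring_number (R : realType) (k p : nat) (F : finFieldType) : \bar R :=
  match pselect (exists s, (0 < s)%N && represents_all k p F s) with
  | left s_ex => (ex_minn s_ex)%:R%:E
  | right _ => +oo%E
  end.

(* Main.v *)
(* Let A be the group of k-th powers of norm-one elements, t = #|A|, q = p ^ 2,
   and S(a) = \sum_(u in A) psi(a u).  On the norm-one circle u + v = w != 0
   determines u v = w / w ^ p, hence {u, v}, so the number J(w) of such pairs
   is at most 2 and the additive energy E = \sum_w J(w)^2 is at most 3 t^2.
   Since S(a u) = S(a) for u in A, t S(a)^2 = \sum_w J(w) S(a w); two uses of
   Cauchy-Schwarz and the fourth moment \sum_a |S(a)|^4 = q E give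
   |S(a)|^8 <= q E^2 for a != 0, which is nontrivial as soon as t exceeds
   p^(1/2).  If c were not a sum of s elements of A, Fourier inversion would
   yield t^s <= \sum_(a != 0) |S(a)|^s <= (q E^2)^((s-4)/8) q E, which fails
   when gcd(k, p+1) <= p^(1/2 - 2/s) / 2.  For s >= 6 this range contains the
   second term of the minimum. *)
Require Import Defs.
From mathcomp Require Import all_boot all_order all_algebra all_field.
From mathcomp Require Import all_fingroup all_character.
From mathcomp Require Import all_classical all_reals all_analysis.
From mathcomp Require Import ring lra.

Set Implicit Arguments.
Unset Strict Implicit.
Unset Printing Implicit Defensive.

Import Order.TTheory GRing.Theory Num.Theory.

Local Open Scope ring_scope.

(** * Additive characters of a finite field *)

Definition nontrivial_char (F : finFieldType) (psi : F -> algC) : Prop :=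
  [/\ {morph psi : x y / x + y >-> x * y}, forall x, `|psi x| = 1
    & exists x, psi x != 1].

Definition char_sum (F : finFieldType) (psi : F -> algC) (A : {set F}) (a : F)
  : algC := \sum_(u in A) psi (a * u).

Definition sum_count (F : finFieldType) (A : {set F}) (w : F) : nat :=
  #|[set u in finset.setX A A | u.1 + u.2 == w]|.

(** The usual count of quadruples with u + v = u' + v', written as the second moment of [sum_count],
    which is what Parseval produces. *)
Definition energy (F : finFieldType) (A : {set F}) : nat :=
  (\sum_w sum_count A w ^ 2)%N.

(** The additive group is abelian, so its irreducible characters are linear; being nontrivial it has
    at least two, and index 0 is the trivial one. *)
Lemma exists_nontrivial_char (F : finFieldType) :
  exists psi : F -> algC, nontrivial_char psi.
Proof.
pose G := [set: F]%G.
have cGG : abelian G by exact: FinRing.zmod_abelian.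
have Gn1 : [set: F] != 1%g.
  apply/eqP => /setP /(_ 1); rewrite !inE => /esym/eqP h.
  by have := oner_neq0 F; rewrite h eqxx.
have : (1 < Nirr G)%N by rewrite NirrE classes_gt1.
move=> N1; pose i : Iirr G := inord 1.
have i0 : i != 0.
  apply/eqP => /(congr1 val) /=.
  rewrite inordK // -(@ltn_predK 1 (Nirr G)) //.
have lin : 'chi_i \is a linear_char by apply/char_abelianP.
exists 'chi_i; split.
- by move=> x y; rewrite -(lin_charM lin) ?inE.
- by move=> x; apply: (normC_lin_char lin); rewrite inE.
- apply/existsP; apply: contraR i0; rewrite negb_exists => /forallP h.
  rewrite -irr_eq1; apply/eqP/cfunP => x.
  by rewrite cfun1E inE; apply/eqP; have := h x; rewrite negbK.
Qed.

Lemma char0 (F : finFieldType) (psi : F -> algC) :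
  nontrivial_char psi -> psi 0 = 1.
Proof.
case=> psiD psi1 _.
have z : psi 0 != 0 by rewrite -normr_eq0 psi1 oner_neq0.
by apply: (mulIf z); rewrite -psiD addr0 mul1r.
Qed.

Lemma char_conj (F : finFieldType) (psi : F -> algC) (x : F) :
  nontrivial_char psi -> (psi x)^* = psi (- x).
Proof.
move=> hpsi; case: (hpsi) => psiD psi1 _.
have z : psi x != 0 by rewrite -normr_eq0 psi1 oner_neq0.
by apply: (mulfI z); rewrite -normCK psi1 -psiD subrr (char0 hpsi) expr1n.
Qed.

(** Orthogonality: for [x != 0], translating [a] by [y / x] multiplies the sum by [psi y != 1], so
    the sum vanishes. *)
Lemma sum_char (F : finFieldType) (psi : F -> algC) (x : F) :
  nontrivial_char psi ->
  \sum_a psi (a * x) = (#|F| * (x == 0%R))%:R.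
Proof.
move=> hpsi; case: (hpsi) => psiD _ [y psiy].
have [->|x0] := eqVneq x 0.
  rewrite muln1 (eq_bigr (fun=> 1)) ?sumr_const // => a _.
  by rewrite mulr0 char0.
rewrite muln0; apply/eqP.
have E : psi y * \sum_a psi (a * x) = \sum_a psi (a * x).
  rewrite [RHS](reindex_inj (addrI (y / x))) /= mulr_sumr.
  by apply: eq_bigr => a _; rewrite mulrDl divfK // psiD.
have /eqP : (psi y - 1) * \sum_a psi (a * x) = 0 by rewrite mulrBl E mul1r subrr.
by rewrite mulf_eq0 subr_eq0 (negPf psiy).
Qed.

Lemma parseval (F : finFieldType) (psi : F -> algC) (f : F -> algC) :
  nontrivial_char psi ->
  \sum_a `|\sum_w f w * psi (a * w)| ^+ 2 = #|F|%:R * \sum_w `|f w| ^+ 2.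
Proof.
move=> hpsi; case: (hpsi) => psiD _ _.
transitivity (\sum_a \sum_w \sum_v f w * (f v)^* * psi (a * (w - v))).
  apply: eq_bigr => a _; rewrite normCK rmorph_sum mulr_suml.
  apply: eq_bigr => w _; rewrite mulr_sumr; apply: eq_bigr => v _.
  by rewrite rmorphM /= (char_conj _ hpsi) mulrBr psiD; ring.
rewrite exchange_big mulr_sumr; apply: eq_bigr => w _.
rewrite exchange_big (bigD1 w) //= [X in _ + X]big1 => [|v vw].
  by rewrite -mulr_sumr sum_char // subrr eqxx muln1 addr0 normCK mulrC.
by rewrite -mulr_sumr sum_char // subr_eq0 eq_sym (negPf vw) muln0 mulr0.
Qed.

(** * Pair counts, fourth moment and Cauchy-Schwarz *)

Lemma sum_pairs (F : finFieldType) (A : {set F}) (g : F -> algC) :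
  \sum_(u in A) \sum_(v in A) g (u + v) = \sum_w (sum_count A w)%:R * g w.
Proof.
rewrite pair_big /= (partition_big (fun u : F * F => u.1 + u.2) predT) //=.
apply: eq_bigr => w _.
rewrite (eq_bigr (fun=> g w)) => [|u /andP [_ /eqP ->] //].
rewrite sumr_const mulr_natl; congr (_ *+ _).
by apply: eq_card => u; rewrite !inE.
Qed.

Lemma char_sum_sqr (F : finFieldType) (psi : F -> algC) (A : {set F}) (a : F) :
  nontrivial_char psi ->
  char_sum psi A a ^+ 2 = \sum_w (sum_count A w)%:R * psi (a * w).
Proof.
case=> psiD _ _; rewrite -(sum_pairs A (fun w => psi (a * w))) expr2 mulr_suml.
apply: eq_bigr => u _; rewrite mulr_sumr; apply: eq_bigr => v _.
by rewrite mulrDr psiD.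
Qed.

(** Parseval applied to the square of the character sum, whose Fourier coefficients are the pair
    counts. *)
Lemma char_sum_fourth_moment (F : finFieldType) (psi : F -> algC) (A : {set F}) :
  nontrivial_char psi ->
  \sum_a `|char_sum psi A a| ^+ 4 = (#|F| * energy A)%:R.
Proof.
move=> hpsi; rewrite natrM natr_sum.
under [in RHS]eq_bigr do rewrite natrX -normr_nat.
rewrite -(parseval _ hpsi); apply: eq_bigr => a _.
by rewrite -char_sum_sqr // normrX -exprM.
Qed.

Lemma sum_sum_count (F : finFieldType) (A : {set F}) :
  (\sum_w sum_count A w = #|A| ^ 2)%N.
Proof.
rewrite -mulnn -cardsX -sum1_card.
rewrite (partition_big (fun u : F * F => u.1 + u.2) predT) //=.
by apply: eq_bigr => w _; rewrite /sum_count -sum1_card; apply: eq_bigl => u;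
  rewrite !inE.
Qed.

Lemma cauchy_schwarz (C : numDomainType) (I : finType) (w x y : I -> C) :
  (forall i, 0 <= w i) -> (forall i, 0 <= x i) -> (forall i, 0 <= y i) ->
  (\sum_i w i * (x i * y i)) ^+ 2 <=
    (\sum_i w i * x i ^+ 2) * (\sum_i w i * y i ^+ 2).
Proof.
move=> w0 x0 y0; rewrite -subr_ge0 -(pmulrn_lge0 _ (ltn0Sn 1)).
set X := \sum_i w i * x i ^+ 2; set Y := \sum_i w i * y i ^+ 2.
set Z := \sum_i w i * (x i * y i).
(* Lagrange's identity; the factor 2 lets the sum run over all ordered pairs. *)
have -> : (X * Y - Z ^+ 2) *+ 2 =
    \sum_i \sum_j w i * w j * (x i * y j - x j * y i) ^+ 2.
  transitivity (\sum_i ((w i * x i ^+ 2) * Y + (w i * y i ^+ 2) * X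
     - (w i * (x i * y i)) * Z *+ 2)).
    by rewrite sumrB big_split /= sumrMnl -!mulr_suml -/X -/Y -/Z; ring.
  apply: eq_bigr => i _.
  rewrite !mulr_sumr -sumrMnl -big_split -sumrB /=; apply: eq_bigr => j _.
  by ring.
apply: sumr_ge0 => i _; apply: sumr_ge0 => j _.
apply: mulr_ge0; first exact: mulr_ge0.
(* In a [numDomainType] such as [algC] a square is known to be nonnegative only for a real base,
   whence the sign hypotheses on [x] and [y]. *)
by apply: real_exprn_even_ge0; rewrite // rpredB // ger0_real // mulr_ge0.
Qed.

(** * Character sums over a multiplicatively closed set *)

Section MulClosed.

Variables (F : finFieldType) (A : {set F}).
Hypothesis A0 : 0 \notin A.
Hypothesis AM : {in A &, forall x y, x * y \in A}.

(** Multiplication by [u] is injective from the finite set [A] to itself, hence onto, which gives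
    the implication from left to right. *)
Lemma mul_closed_mem (u v : F) : u \in A -> (u * v \in A) = (v \in A).
Proof.
move=> uA; have u0 : u != 0 by apply: contraNneq A0 => <-.
have /eqP E : [set u * x | x in A] == A.
  rewrite eqEcard card_imset ?leqnn ?andbT; last exact: mulfI.
  by apply/fintype.subsetP => _ /imsetP [x xA ->]; apply: AM.
by rewrite -{1}E mem_imset //; apply: mulfI.
Qed.

Lemma char_sum_mul (psi : F -> algC) (a u : F) :
  u \in A -> char_sum psi A (a * u) = char_sum psi A a.
Proof.
move=> uA; have u0 : u != 0 by apply: contraNneq A0 => <-.
rewrite /char_sum [RHS](reindex_inj (mulfI u0)) /=.
by apply: eq_big => v; rewrite ?mul_closed_mem // mulrA.
Qed.

(** Averages the squared sum over the orbit of [a] under [A], where it is constant, then expands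
    each square by pair counts and swaps the sums. *)
Lemma char_sum_self_improve (psi : F -> algC) (a : F) : nontrivial_char psi ->
  #|A|%:R * char_sum psi A a ^+ 2 =
    \sum_w (sum_count A w)%:R * char_sum psi A (a * w).
Proof.
move=> hpsi.
transitivity (\sum_(x in A) char_sum psi A (a * x) ^+ 2).
  rewrite (eq_bigr (fun=> char_sum psi A a ^+ 2)) => [|x xA].
    by rewrite sumr_const mulr_natl.
  by rewrite char_sum_mul.
under eq_bigr do rewrite char_sum_sqr //.
rewrite exchange_big; apply: eq_bigr => w _; rewrite mulr_sumr.
by apply: eq_bigr => x _; rewrite mulrAC.
Qed.

Lemma char_sum_bound (psi : F -> algC) (a : F) : nontrivial_char psi ->
  (0 < #|A|)%N -> a != 0 ->
  `|char_sum psi A a| ^+ 8 <= (#|F| * energy A ^ 2)%:R.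
Proof.
move=> hpsi cA a0.
pose J w : algC := (sum_count A w)%:R; pose S w := `|char_sum psi A (a * w)|.
have J0 w : 0 <= J w by apply: ler0n.
have S0 w : 0 <= S w by apply: normr_ge0.
pose X1 := \sum_w J w * S w; pose X2 := \sum_w J w * S w ^+ 2.
have h1 : #|A|%:R * `|char_sum psi A a| ^+ 2 <= X1.
  rewrite -normrX -[X in X * _]normr_nat -normrM char_sum_self_improve //.
  by apply: le_trans (ler_norm_sum _ _ _) _; apply: ler_sum => w _;
    rewrite normrM normr_nat.
have X10 : 0 <= X1 by apply: sumr_ge0 => w _; apply: mulr_ge0.
have X20 : 0 <= X2 by apply: sumr_ge0 => w _; rewrite mulr_ge0 ?exprn_ge0.
(* Cauchy-Schwarz with weight [J], whose total mass is [#|A| ^ 2]. *)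
have h2 : X1 ^+ 2 <= #|A|%:R ^+ 2 * X2.
  rewrite -natrX -sum_sum_count natr_sum.
  have -> : X1 = \sum_w J w * (1 * S w) by apply: eq_bigr => w _; rewrite mul1r.
  apply: le_trans (cauchy_schwarz J0 (fun=> ler01) S0) _ => /=.
  by rewrite (eq_bigr J) // => w _; rewrite expr1n mulr1.
(* Unweighted Cauchy-Schwarz separates the energy from the fourth moment; [a != 0] makes [w] to
   [a * w] a bijection. *)
have h3 : X2 ^+ 2 <= (#|F| * energy A ^ 2)%:R.
  have -> : X2 = \sum_w 1 * (J w * S w ^+ 2).
    by apply: eq_bigr => w _; rewrite mul1r.
  apply: le_trans (cauchy_schwarz (fun=> ler01) J0 (fun w => exprn_ge0 2 (S0 w))) _.
  rewrite (_ : (#|F| * energy A ^ 2)%:R = (energy A)%:R * (#|F| * energy A)%:R);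
    last by rewrite -natrM; congr _%:R; ring.
  have -> : (energy A)%:R = \sum_w 1 * J w ^+ 2.
    by rewrite natr_sum; apply: eq_bigr => w _; rewrite mul1r natrX.
  have -> // : (#|F| * energy A)%:R = \sum_w 1 * (S w ^+ 2) ^+ 2.
  rewrite -(char_sum_fourth_moment A hpsi) (reindex_inj (mulfI a0)).
  by apply: eq_bigr => w _; rewrite mul1r -exprM.
(* Chaining [h1] to the fourth power, [h2] squared and [h3] puts [#|A| ^ 4] on both sides, where it
   cancels. *)
have T0 : 0 < #|A|%:R ^+ 4 :> algC by rewrite exprn_gt0 // ltr0n.
rewrite -(ler_pM2l T0).
apply: (@le_trans _ _ (X1 ^+ 4)).
  have := h1; rewrite -(@ler_pXn2r _ 4) ?nnegrE ?mulr_ge0 ?exprn_ge0 //.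
  by rewrite exprMn -exprM.
apply: (@le_trans _ _ ((#|A|%:R ^+ 2 * X2) ^+ 2)).
  rewrite (exprM X1 2 2) ler_pXn2r // ?nnegrE ?exprn_ge0 //.
  by rewrite mulr_ge0 ?exprn_ge0.
by rewrite exprMn -exprM ler_wpM2l // exprn_ge0.
Qed.

(** With M the eighth root of q E^2, the numerical hypothesis is the eighth power of M^(s-4) q E <
    t^s, which keeps it in natural numbers. *)
Lemma sums_cover (s : nat) (c : F) : (3 < s)%N -> (0 < #|A|)%N ->
  (#|F| ^ (s + 4) * energy A ^ (2 * s) < #|A| ^ (8 * s))%N ->
  exists2 u : {ffun 'I_s -> F}, forall i, u i \in A & \sum_i u i = c.
Proof.
move=> s3 cA hlt.
have [psi hpsi] := exists_nontrivial_char F; case: (hpsi) => psiD psi1 _.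
pose P := [exists u : {ffun 'I_s -> F}, (u \in ffun_on A) && (\sum_i u i == c)].
have [/existsP [u /andP [/ffun_onP uA /eqP uc]]|nP] := boolP P; first by exists u.
exfalso.
have psi_sum (I : finType) (g : I -> F) : psi (\sum_i g i) = \prod_i psi (g i).
  by apply: (big_morph psi psiD); apply: char0.
pose S a := char_sum psi A a.
(* By orthogonality this sum is [#|F|] times the number of representations of [c], assumed to be
   zero. *)
have hz : \sum_a S a ^+ s * psi (- (a * c)) = 0.
  transitivity (\sum_a \sum_(u : {ffun 'I_s -> F} | u \in ffun_on A)
                  psi (a * (\sum_i u i - c))).
    apply: eq_bigr => a _.
    rewrite -[in S a ^+ s](card_ord s) -prodr_const bigA_distr_big mulr_suml.
    apply: eq_bigr => u _.
    by rewrite mulrBr psiD mulr_sumr psi_sum.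
  rewrite exchange_big big1 // => u uA.
  rewrite sum_char // subr_eq0.
  have /negbTE -> : \sum_i u i != c; last by rewrite muln0.
  by apply: contraNneq nP => uc; apply/existsP; exists u; rewrite uA uc eqxx.
pose B : algC := (#|F| * energy A ^ 2)%:R.
pose M := 8.-root B.
have B0 : 0 <= B by apply: ler0n.
have M0 : 0 <= M by rewrite rootC_ge0.
have M8 : M ^+ 8 = B by rewrite rootCK.
have SM a : a != 0 -> `|S a| <= M.
  move=> a0; rewrite -(@ler_pXn2r _ 8) ?nnegrE // M8.
  exact: char_sum_bound.
have S0 : S 0 = #|A|%:R.
  rewrite /S /char_sum (eq_bigr (fun=> 1)) ?sumr_const // => u _.
  by rewrite mul0r char0.
(* The term at 0 is balanced by the others. Of their s factors, s - 4 are bounded by [M] and four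
   are left for the fourth moment, to which the term at 0 is added back. *)
have main : #|A|%:R ^+ s <= M ^+ (s - 4) * (#|F| * energy A)%:R.
  move: hz; rewrite (bigD1 0) //= mul0r oppr0 (char0 hpsi) mulr1 S0.
  move/eqP; rewrite addr_eq0 => /eqP h.
  rewrite -normr_nat -normrX h normrN.
  apply: le_trans (ler_norm_sum _ _ _) _.
  rewrite -(char_sum_fourth_moment A hpsi) mulr_sumr.
  apply: (@le_trans _ _ (\sum_(a | a != 0) M ^+ (s - 4) * `|S a| ^+ 4)).
    apply: ler_sum => a a0; rewrite normrM psi1 mulr1 normrX.
    rewrite -{1}(subnK s3) exprD ler_wpM2r ?exprn_ge0 //.
    by rewrite lerXn2r ?nnegrE // SM.
  rewrite [leRHS](bigD1 0) //= lerDr mulr_ge0 ?exprn_ge0 //.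
have : (#|A| ^ (8 * s) <= #|F| ^ (s + 4) * energy A ^ (2 * s))%N.
  rewrite -(ler_nat algC).
  move: main; rewrite -(@ler_pXn2r _ 8) ?nnegrE ?exprn_ge0 ?mulr_ge0 ?exprn_ge0 //.
  rewrite -exprM mulnC natrX => /le_trans; apply.
  rewrite exprMn -exprM mulnC exprM M8 -!natrX -natrM ler_nat.
  rewrite !expnMn mulnACA -!expnD.
  have -> : (s - 4 + 8 = s + 4)%N by rewrite -{2}(subnK s3) -addnA.
  by have -> // : (s - 4 + (s - 4) + 8 = 2 * s)%N by rewrite mul2n -addnn -{3 4}(subnK s3); ring.
by rewrite leqNgt hlt.
Qed.

End MulClosed.

(** * Sizes of the norm-one group and of its k-th powers *)

Lemma leq_card_imset_fibers (T U : finType) (f : T -> U) (D : {set T}) (n : nat) :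
  (forall x, x \in D -> #|[set y in D | f y == f x]| <= n)%N ->
  (#|D| <= n * #|f @: D|)%N.
Proof.
move=> fn; rewrite -sum1_card (partition_big_imset f) /= mulnC -sum_nat_const.
apply: leq_sum => _ /imsetP [x xD ->]; apply: leq_trans (fn x xD).
by rewrite -sum1_card; apply: eq_leq; apply: eq_bigl => y; rewrite inE.
Qed.

Lemma card_roots_unity (F : finFieldType) (n : nat) (D : {set F}) : (0 < n)%N ->
  {in D, forall x, x ^+ n = 1} -> (#|D| <= n)%N.
Proof.
move=> n0 Dn; rewrite cardE.
apply: (max_unity_roots n0); last exact: enum_uniq.
by apply/allP => x; rewrite mem_enum => /Dn h; apply/unity_rootP.
Qed.

(** Division by the fixed [x] injects [D] into the n-th roots of unity. *)
Lemma card_expr_fiber (F : finFieldType) (n : nat) (D : {set F}) (x : F) :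
  (0 < n)%N -> 0 \notin D -> x \in D -> {in D &, forall y z, (y / z) ^+ n = 1} ->
  (#|D| <= n)%N.
Proof.
move=> n0 D0 xD h; have x0 : x != 0 by apply: contraNneq D0 => <-.
rewrite -(card_imset D (mulIf (invr_neq0 x0))).
apply: (card_roots_unity n0) => _ /imsetP [y yD ->]; exact: h.
Qed.

Lemma normOne_neq0 (p : nat) (F : finFieldType) (u : F) :
  u \in normOne p F -> u != 0.
Proof.
rewrite inE; apply: contraTneq => ->.
by rewrite expr0n /= eq_sym oner_neq0.
Qed.

(** The power map of exponent p - 1 sends the p^2 - 1 units into the norm-one group, with fibres of
    size at most p - 1. *)
Lemma card_normOne (p : nat) (F : finFieldType) :
  prime p -> #|F| = (p ^ 2)%N -> (p.+1 <= #|normOne p F|)%N.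
Proof.
move=> p_pr cF; have p1 := prime_gt1 p_pr.
have pp : (0 < p.-1)%N by rewrite -subn1 subn_gt0.
pose D := [set~ (0 : F)].
have cD : #|D| = (p.+1 * p.-1)%N.
  by rewrite cardsC1 cF -[p](prednK (ltnW p1)) -mulnn mulSn /=; ring.
have h : (#|D| <= p.-1 * #|(fun z => z ^+ p.-1) @: D|)%N.
  apply: leq_card_imset_fibers => x; rewrite !inE => x0.
  apply: (@card_expr_fiber _ _ _ x); rewrite ?inE ?x0 ?eqxx //.
  move=> y z; rewrite !inE => /andP [y0 /eqP yx] /andP [z0 /eqP zx].
  by rewrite expr_div_n yx zx divff // expf_neq0.
move: h; rewrite cD mulnC leq_pmul2l // => h; apply: leq_trans h _.
apply/subset_leq_card/fintype.subsetP => _ /imsetP [z + ->]; rewrite !inE => z0.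
rewrite -exprM mulnC -cD cardsC1; apply/eqP; apply: (mulfI z0).
by rewrite mulr1 -exprS prednK ?expf_card // cF expn_gt0 (ltnW p1).
Qed.

(** Two norm-one elements with equal k-th powers have a ratio killed by both k and p + 1, hence by
    their gcd (Bezout), which bounds the fibres. *)
Lemma card_normOne_powers (k p : nat) (F : finFieldType) :
  prime p -> #|F| = (p ^ 2)%N ->
  (p.+1 <= gcdn k p.+1 * #|(fun z => z ^+ k) @: normOne p F|)%N.
Proof.
move=> p_pr cF; apply: leq_trans (card_normOne p_pr cF) _.
have d0 : (0 < gcdn k p.+1)%N by rewrite gcdn_gt0 orbT.
apply: leq_card_imset_fibers => x xN; have x0 := normOne_neq0 xN.
apply: (@card_expr_fiber _ _ _ x) => //; last 2 first.
- by rewrite inE xN eqxx.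
- move=> y z; rewrite inE => /andP [yN /eqP yx]; rewrite inE => /andP [zN /eqP zx].
  have z0 := normOne_neq0 zN.
  have e1 : (y / z) ^+ k == 1 by rewrite expr_div_n yx zx divff // expf_neq0.
  have e2 : (y / z) ^+ p.+1 == 1.
    move: yN zN; rewrite !inE expr_div_n => /eqP -> /eqP ->.
    by rewrite divr1.
  have [->|k0] := posnP k; first by rewrite gcd0n (eqP e2).
  case: (egcdnP p.+1 k0) => m n e _.
  have := congr1 (GRing.exp (y / z)) e.
  by rewrite exprD ![(_ * k)%N]mulnC ![(_ * p.+1)%N]mulnC !exprM (eqP e1) (eqP e2)
    !expr1n mul1r.
- by apply/negP; rewrite inE => /andP [/normOne_neq0]; rewrite eqxx.
Qed.

(** * Additive energy of subsets of the norm-one group *)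

Lemma sum_count_normOne (p : nat) (F : finFieldType) (A : {set F}) (w : F) :
  p \in [pchar F] -> A \subset normOne p F -> w != 0 -> (sum_count A w <= 2)%N.
Proof.
move=> pF /fintype.subsetP AN w0.
(* On the norm-one group u^p = 1/u, so Frobenius gives w^p = 1/u + 1/v = w/(uv). *)
have prod_eq u v : u \in A -> v \in A -> u + v = w -> u * v * w ^+ p = w.
  move=> /AN; rewrite inE => /eqP uN /AN; rewrite inE => /eqP vN <-.
  rewrite -(pFrobenius_autE pF) pFrobenius_autD_comm; last exact: mulrC.
  rewrite !pFrobenius_autE mulrDr -mulrA [v * _]mulrC mulrA -exprS uN.
  by rewrite -mulrA -exprS vN mul1r mulr1 addrC.
rewrite /sum_count; have [->|[u0]] := set_0Vmem [set u in finset.setX A A | u.1 + u.2 == w].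
  by rewrite cards0.
rewrite !inE => /andP [/andP [a0 b0] /eqP s0].
apply: (@leq_trans #|[set (u0.1, u0.2); (u0.2, u0.1)]|); last by rewrite cards2; case: eqP.
apply/subset_leq_card/fintype.subsetP => -[x y]; rewrite !inE /= => /andP [/andP [xA yA] /eqP xy].
have e : x * y = u0.1 * u0.2.
  apply: (@mulIf _ (w ^+ p)); first by rewrite expf_neq0.
  by rewrite !prod_eq.
have ey : y = u0.1 + u0.2 - x by rewrite s0 -xy addrC addKr.
(* Same sum and same product: [x] is a root of the quadratic with roots [u0.1] and [u0.2]. *)
have /eqP : (x - u0.1) * (x - u0.2) = 0.
  by transitivity (u0.1 * u0.2 - x * y); [rewrite ey; ring | rewrite e subrr].
rewrite mulf_eq0 !subr_eq0 => /orP [] /eqP ex; apply/orP; [left|right];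
  by apply/eqP; rewrite ey ex; congr (_, _); ring.
Qed.

Lemma sum_count0 (F : finFieldType) (A : {set F}) : (sum_count A 0%R <= #|A|)%N.
Proof.
rewrite /sum_count -(@card_in_imset _ _ fst) => [|[x y] [x' y']].
  by apply/subset_leq_card/fintype.subsetP => _ /imsetP [u + ->]; rewrite !inE -andbA => /andP [].
rewrite !inE /= => /andP [_ /eqP h] /andP [_ /eqP h'] e.
by move: h h'; rewrite e => <- /addrI ->.
Qed.

(** The zero sum contributes at most t^2, and the nonzero ones at most twice the total number t^2 of
    pairs. *)
Lemma energy_normOne (p : nat) (F : finFieldType) (A : {set F}) :
  p \in [pchar F] -> A \subset normOne p F -> (energy A <= 3 * #|A| ^ 2)%N.
Proof.
move=> pF AN; rewrite /energy (bigD1 0) //= mulSn leq_add //.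
  by rewrite leq_exp2r // sum_count0.
apply: (@leq_trans (\sum_(w | w != 0%R) 2 * sum_count A w)%N).
  apply: leq_sum => w w0; rewrite -mulnn leq_mul2r.
  by rewrite (sum_count_normOne pF AN w0) orbT.
by rewrite -sum_sum_count big_distrr [leqRHS](bigD1 0) //= leq_addl.
Qed.

(** * From the energy bound to the Waring number *)

Lemma represents_all_small_gcd (k p s : nat) (F : finFieldType) :
  prime p -> #|F| = (p ^ 2)%N -> (3 < s)%N ->
  (4 ^ s * gcdn k p.+1 ^ (2 * s) <= p ^ (s - 4))%N -> represents_all k p F s.
Proof.
move=> p_pr cF s3 hd.
have pF := card_finPcharP cF p_pr.
have := card_normOne_powers k p_pr cF.
set A := _ @: _ => dA.
have AN : A \subset normOne p F.
  apply/fintype.subsetP => _ /imsetP [z zN ->]; move: zN; rewrite !inE => /eqP zN.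
  by rewrite -exprM mulnC exprM zN expr1n.
have A0 : 0 \notin A by apply/negP => /(fintype.subsetP AN) /normOne_neq0; rewrite eqxx.
have AM : {in A &, forall x y, x * y \in A}.
  move=> _ _ /imsetP [x xN ->] /imsetP [y yN ->].
  rewrite -exprMn; apply: imset_f; move: xN yN; rewrite !inE => /eqP xN /eqP yN.
  by rewrite exprMn xN yN mulr1.
have cA : (0 < #|A|)%N by move: dA; case: #|A|; rewrite ?muln0.
have p0 := prime_gt0 p_pr.
(* Square root of what [sums_cover] needs once q = p^2 and E <= 3 t^2 are inserted. The 3 is relaxed
   to 4 = 2^2 to match [hd]; strictness comes from p < p + 1 <= gcd * t. *)
have key : (3 ^ s * p ^ (s + 4) < #|A| ^ (2 * s))%N.
  apply: (@leq_ltn_trans (4 ^ s * p ^ (s + 4))%N).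
    by rewrite leq_mul2r leq_exp2r ?orbT // (leq_trans _ s3).
  rewrite -(@ltn_pmul2l (p ^ (s - 4))) ?expn_gt0 ?p0 //.
  apply: leq_trans (leq_mul hd (leqnn _)).
  rewrite -mulnA -expnMn mulnCA -expnD.
  have -> : (s - 4 + (s + 4) = 2 * s)%N by rewrite addnCA subnK // mul2n addnn.
  by rewrite ltn_pmul2l ?expn_gt0 // ltn_exp2r // muln_gt0 (leq_trans _ s3).
have hlt : (#|F| ^ (s + 4) * energy A ^ (2 * s) < #|A| ^ (8 * s))%N.
  apply: (@leq_ltn_trans ((3 ^ s * p ^ (s + 4) * #|A| ^ (2 * s)) ^ 2)%N).
    have := energy_normOne pF AN.
    rewrite -(@leq_exp2r _ _ (2 * s)) ?muln_gt0 ?(leq_trans _ s3) //.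
    move=> /(leq_mul (leqnn (#|F| ^ (s + 4)))) /leq_trans; apply.
    rewrite cF !expnMn -!expnM; apply: eq_leq.
    rewrite [(s * 2)%N]mulnC [((s + 4) * 2)%N]mulnC [(2 * s * 2)%N]mulnC; rewrite !mul2n -!addnn !expnD; ring.
  have -> : (8 * s = (2 * s + 2 * s) * 2)%N by ring.
  rewrite [ltnRHS]expnM ltn_exp2r // [ltnRHS]expnD ltn_pmul2r //.
  by rewrite expn_gt0 cA.
apply/forallP => c; have [u uA uc] := sums_cover A0 AM c s3 cA hlt.
have h i : exists z, (z \in normOne p F) && (z ^+ k == u i).
  by have /imsetP [z zN ->] := uA i; exists z; rewrite zN eqxx.
apply/existsP; exists [ffun i => xchoose (h i)]; apply/andP; split.
  by apply/forallP => i; rewrite ffunE; case/andP: (xchooseP (h i)).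
rewrite -uc; apply/eqP/eq_bigr => i _; rewrite ffunE.
by case/andP: (xchooseP (h i)) => _ /eqP.
Qed.

Lemma waring_number_le (R : realType) (k p : nat) (F : finFieldType) (s : nat) :
  (0 < s)%N -> represents_all k p F s -> (waring_number R k p F <= s%:R%:E)%E.
Proof.
move=> s0 hs; rewrite /waring_number; case: pselect => [ex|[]]; last first.
  by exists s; rewrite s0 hs.
by case: ex_minnP => m _ /(_ s); rewrite s0 hs lee_fin ler_nat; apply.
Qed.

Lemma gcd_bound (R : realType) (s p d : nat) : (5 < s)%N -> (0 < p)%N ->
  d%:R <= 1 / 2 * p%:R `^ ((5 * s%:R - 56) / (10 * s%:R - 56)) :> R ->
  (4 ^ s * d ^ (2 * s) <= p ^ (s - 4))%N.
Proof.
move=> s5 p0 hd.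
have s5R : 6 <= s%:R :> R by rewrite ler_nat.
have p1R : 1 <= p%:R :> R by rewrite ler1n.
have hd2 : 2 * d%:R <= p%:R `^ ((s%:R - 4) / (2 * s%:R)) :> R.
  (* For s >= 6 both denominators are positive, and cross-multiplying the exponents leaves 0 <= 16 s
     + 224. *)
  apply: le_trans (ler_powR p1R (x := (5 * s%:R - 56) / (10 * s%:R - 56)) _).
    by move: hd; lra.
  rewrite ler_pdivrMr; last lra.
  rewrite mulrAC ler_pdivlMr; last lra.
  nra.
rewrite -(ler_nat R) natrM !natrX (_ : 4%:R = 2 ^+ 2); last by ring.
rewrite -exprM -exprMn.
have -> : p%:R ^+ (s - 4) = (p%:R `^ ((s%:R - 4) / (2 * s%:R))) ^+ (2 * s) :> R.
  rewrite -!powR_mulrn ?powR_ge0 ?ler0n // -powRrM.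
  congr (_ `^ _); rewrite natrB ?(leq_trans _ s5) // natrM divfK //.
  by apply: lt0r_neq0; lra.
by rewrite lerXn2r ?nnegrE ?mulr_ge0 ?powR_ge0 ?ler0n.
Qed.

Theorem theorem1p3 (R : realType) :
  exists C : R, 0 < C /\
    forall s : nat, (4 < s)%N -> ~~ odd s ->
    forall (p k : nat) (F : finFieldType),
      prime p -> (0 < k)%N -> #|F| = (p ^ 2)%N ->
      p%:R `^ (1 / 6) <= (gcdn k p.+1)%:R :> R ->
      (gcdn k p.+1)%:R <=
        C * Num.min
              (p%:R `^ ((6 * s%:R - 186) / (11 * s%:R - 116)))
              (p%:R `^ ((5 * s%:R - 56) / (10 * s%:R - 56))) ->
      (waring_number R k p F <= s%:R%:E)%E.
Proof.
(* The constant absorbs the 4^s = 2^(2s) of [represents_all_small_gcd]. *)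
exists (1 / 2); split; first lra.
move=> s s4 s_even p k F p_pr _ cF _ hd.
(* Parity excludes s = 5, where 10 s - 56 would be negative. *)
have s5 : (5 < s)%N by rewrite ltn_neqAle s4 andbT; apply: contraNneq s_even => <-.
apply: waring_number_le; first exact: leq_trans s5.
apply: represents_all_small_gcd => //; first exact: leq_trans s5.
apply: (@gcd_bound R) => //; first exact: prime_gt0.
apply: le_trans hd _; apply: ler_wpM2l; first lra.
by rewrite ge_min lexx orbT.
Qed.
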